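(* Let $\mu^0$ and $\mu^{\mathcal T}$ be probability measures on $[0,t_f]$ and let $w(v_0,v_1),w(v_1,v_2)>0$. For sufficiently large $r$, the following problem (independent departure–arrival constraints with a single intermediate node) admits a minimizing solution $\pi$: determine $\pi\in\mathcal M_+([0,t_f]^3)$ that minimizes $$\iiint_{t_0,t_1,t_2} c(t_0,t_1,t_2)\,\pi(dt_0,dt_1,dt_2),\qquad c(t_0,t_1,t_2)=\frac{w(v_0,v_1)}{t_1-t_0}+\frac{w(v_1,v_2)}{t_2-t_1},$$ subject to the departure and arrival constraints $$\iint_{t_1,t_2}\pi(dt_0,dt_1,dt_2)=\mu^0(t_0),\qquad \iint_{t_0,t_1}\pi(dt_0,dt_1,dt_2)=\mu^{\mathcal T}(t_2),$$ and the flow-rate constraint $$\iint_{t_0,t_2}\pi(dt_0,dt_1,dt_2)=:\sigma^1(dt_1)\le r\,dt_1 .$$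
   Context: $t_f>0$ is the time horizon and $\mathcal M_+([0,t_f]^3)$ is the set of nonnegative measures on $[0,t_f]^3$. The coordinates $t_0,t_1,t_2$ are the times at which mass departs from the source $v_0$, crosses the intermediate node $v_1$, and arrives at the sink $v_2$; $w(v_0,v_1)$ and $w(v_1,v_2)$ are the positive weights of the two edges. The measures $\mu^0$ and $\mu^{\mathcal T}$ prescribe the departure and arrival rates, and $r>0$ is the flow-rate bound at $v_1$. The formula for $c$ is used for ordered times $t_0<t_1<t_2$, and $c=+\infty$ otherwise. *)

(* Defs.v *)
From HB Require Import structures.
From mathcomp Require Import all_boot all_order all_algebra.
From mathcomp Require Import all_classical all_reals all_analysis.

Set Implicit Arguments.
Unset Strict Implicit.
Unset Printing Implicit Defensive.
Import Order.TTheory GRing.Theory Num.Theory.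
Import numFieldNormedType.Exports.

Local Open Scope classical_set_scope.
Local Open Scope ring_scope.

(* Measures on [0, tf] (resp. [0, tf]^3) are encoded as Borel measures on the
   line (resp. on its product R * R * R) that vanish outside that set. *)

Definition time_space (R : realType) :=
  (measurableTypeR R * measurableTypeR R * measurableTypeR R)%type.

Definition horizon (R : realType) (tf : R) : set (measurableTypeR R) :=
  `[0, tf]%classic.

Definition time_cube (R : realType) (tf : R) : set (time_space R) :=
  horizon tf `*` horizon tf `*` horizon tf.

Definition concentrated_on d (T : measurableType d) (R : realType)
    (mu : set T -> \bar R) (D : set T) : Prop :=
  mu (~` D) = 0%E.

Definition departure (R : realType) (t : time_space R) : measurableTypeR R :=
  t.1.1.
Definition crossing (R : realType) (t : time_space R) : measurableTypeR R :=
  t.1.2.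
Definition arrival (R : realType) (t : time_space R) : measurableTypeR R :=
  t.2.

Definition transport_cost (R : realType) (w01 w12 : R) (t : time_space R) :
    \bar R :=
  let t0 : R := departure t in
  let t1 : R := crossing t in
  let t2 : R := arrival t in
  if (t0 < t1) && (t1 < t2) then (w01 / (t1 - t0) + w12 / (t2 - t1))%:E
  else +oo%E.

Definition total_cost (R : realType) (tf w01 w12 : R)
    (pi : {measure set (time_space R) -> \bar R}) : \bar R :=
  (\int[pi]_(t in time_cube tf) transport_cost w01 w12 t)%E.

Definition feasible (R : realType) (tf r : R)
    (mu0 muT : probability (measurableTypeR R) R)
    (pi : {measure set (time_space R) -> \bar R}) : Prop :=
  [/\ concentrated_on pi (time_cube tf),
      (forall A : set (measurableTypeR R), measurable A ->
         pushforward pi (@departure R) A = mu0 A),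
      (forall A : set (measurableTypeR R), measurable A ->
         pushforward pi (@arrival R) A = muT A)
    & (forall A : set (measurableTypeR R), measurable A ->
         (pushforward pi (@crossing R) A <= r%:E * lebesgue_measure A)%E)].

Definition minimizer (R : realType) (tf w01 w12 r : R)
    (mu0 muT : probability (measurableTypeR R) R)
    (pi : {measure set (time_space R) -> \bar R}) : Prop :=
  feasible tf r mu0 muT pi /\
  forall pi' : {measure set (time_space R) -> \bar R},
    feasible tf r mu0 muT pi' ->
    (total_cost tf w01 w12 pi <= total_cost tf w01 w12 pi')%E.

(* Main.v *)
(** Direct method, with setwise limits on boxes in place of weak compactness.

    Along a minimizing sequence, pass to the limit of [pi_n (A x B x C)] along
    an ultrafilter, for all Borel [A], [B], [C].  The limit is finitely
    additive; since the departure and arrival marginals are fixed and the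
    crossing marginal is bounded by [r] times Lebesgue measure on the horizon,
    all three marginals are dominated by fixed finite (hence regular) measures,
    so a box is approximated by compact boxes from inside and open boxes from
    outside uniformly in [n], and the limit is countably subadditive on boxes.
    Its Caratheodory extension [pi] satisfies the constraints.

    The cost is a pointwise limit of step functions on grid boxes lying below
    it; their integrals pass to the limit, and Fatou's lemma gives lower
    semicontinuity.  For [r >= 1 / tf] the product of [mu0], the uniform law and
    [muT] is feasible. *)
Require Import Defs.
From HB Require Import structures.
From mathcomp Require Import all_boot all_order all_algebra.
From mathcomp Require Import all_classical all_reals all_analysis.
From mathcomp Require Import lra measurable_realfun.
Set Implicit Arguments.
Unset Strict Implicit.
Import Order.TTheory GRing.Theory Num.Theory.
Import numFieldNormedType.Exports.
Local Open Scope classical_set_scope.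
Local Open Scope ring_scope.

(** * Regularity of finite Borel measures *)

(** Continuity from above, packaged to extract one good index; it replaces a countable operation by
    a finite stage in the regularity proofs. *)
Lemma nonincreasing_measure_lt d (T : measurableType d) (R : realType)
    (mu : {measure set T -> \bar R}) (D : (set T)^nat) (e : \bar R) :
  (mu (D 0%N) < +oo)%E -> (forall n, measurable (D n)) -> nonincreasing_seq D ->
  (mu (\bigcap_n D n) < e)%E -> exists n, (mu (D n) < e)%E.
Proof.
move=> D0 mD Dn De.
have cD := nonincreasing_cvg_mu D0 mD (bigcapT_measurable mD) Dn.
have : \forall n \near \oo, (mu (D n) < e)%E.
  exact: (cD _ (open_ereal_lt' De)).
exact: filter_ex.
Qed.

(** Good-sets argument: the sets admitting such an approximation form a sigma-algebra, and it
    contains the open rays, which generate the Borel sets. *)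
Lemma finite_measure_closed_open (R : realType)
    (mu : {measure set (measurableTypeR R) -> \bar R}) (A : set R) (e : R) :
  (mu setT < +oo)%E -> measurable A -> 0 < e ->
  exists F U : set R,
    [/\ closed F, open U, F `<=` A, A `<=` U & (mu (U `\` F) < e%:E)%E].
Proof.
move=> muT mA; move: A mA e.
have fin (B : set (measurableTypeR R)) : measurable B -> (mu B < +oo)%E.
  by move=> mB; apply: le_lt_trans muT; apply: le_measure; rewrite ?inE.
have mU (B : set R) : open B -> measurable (B : set (measurableTypeR R)).
  by exact: open_measurable.
have mF (B : set R) : closed B -> measurable (B : set (measurableTypeR R)).
  by exact: closed_measurable.
pose G : set (set R) := [set A | forall e : R, 0 < e -> exists F U : set R,
    [/\ closed F, open U, F `<=` A, A `<=` U & (mu (U `\` F) < e%:E)%E]].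
suff sG : (@ocitv R).-sigma.-measurable `<=` G by move=> A /sG.
rewrite RGenOInfty.measurableE; apply: smallest_sub => [|_ [x ->] e e0].
  split=> [e e0|A GA e e0|A GA e e0].
  - exists set0, set0; rewrite set0D measure0 lte_fin.
    by split => //; exact: closed0.
  - have [F [U [cF oU FA AU muUF]]] := GA _ e0.
    exists (~` U), (~` F); rewrite setTD setDE setCK setIC -setDE.
    by split => //; [exact: open_closedC|exact: closed_openC|
      exact: subsetC|exact: subsetC].
  (* These errors sum to [e / 2], which leaves room for the strict inequality required when the
     union of the [F n] is truncated. *)
  - have e4 n : 0 < e / 2 / (2 ^ n.+1)%:R by rewrite !divr_gt0// ltr0n expn_gt0.
    have /choice[F /choice[U FU]] := fun n => GA n _ (e4 n).
    pose V := \bigcup_n U n.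
    have oV : open V by apply: bigcup_open => n _; case: (FU n).
    (* A countable union of closed sets need not be closed, so only finitely many [F i] are kept. A
       point in every [D N] lies in some [U n] and in no [F i], so the intersection is covered by
       the sets [U n] minus [F n]. *)
    pose D N := V `\` \big[setU/set0]_(i < N) F i.
    have cF N : closed (\big[setU/set0]_(i < N) F i).
      by apply: closed_bigsetU => i _; case: (FU i).
    have mD N : measurable (D N : set (measurableTypeR R)).
      by apply: measurableD; [exact: mU|exact: (mF _ (cF N))].
    have mUF n : measurable (U n `\` F n : set (measurableTypeR R)).
      by case: (FU n) => ? ? _ _ _; apply: measurableD; [exact: mU|exact: mF].
    have [|//|||N DN] := @nonincreasing_measure_lt _ _ _ mu D e%:E.
    + exact: (fin _ (mD 0%N)).
    + by move=> m n mn; apply/subsetPset; apply: setDS; exact: subset_bigsetU.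
    + apply: (@le_lt_trans _ _ (mu (\bigcup_n (U n `\` F n)))).
        apply: le_measure; rewrite ?inE; [exact: bigcapT_measurable|
          exact: bigcupT_measurable|].
        move=> t Dt; have [[n _ Unt] _] := Dt 0%N I.
        exists n => //; split=> // Fnt.
        by have [_] := Dt n.+1 I; apply; rewrite big_ord_recr; right.
      apply: (@le_lt_trans _ _ (e / 2)%:E).
        apply: le_trans (epsilon_trick0 xpredT (ltW (divr_gt0 e0 (ltr0Sn _ 1)))).
        apply: (@le_trans _ _ (\sum_(n <oo) mu (U n `\` F n))%E).
          apply: measure_sigma_subadditive => //.
          exact: bigcupT_measurable.
        by apply: lee_nneseries => // n _; apply/ltW; case: (FU n).
      by rewrite lte_fin gtr_pMr// invf_lt1// ltr1n.
    + exists (\big[setU/set0]_(i < N) F i), V; split => //.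
        rewrite -bigcup_mkord => t [n nN Fnt]; exists n => //.
        by case: (FU n) => _ _ + _ _; apply.
      by apply: subset_bigcup => n _; case: (FU n).
(* The ray is its own open set. From inside it is exhausted by closed rays starting at
   [x + n.+1%:R^-1], and the differences decrease to the empty set. *)
have [||||n nD] := @nonincreasing_measure_lt _ _ _ mu
    (fun n => (`]x, +oo[ `\` `[x + n.+1%:R^-1, +oo[)%classic) e%:E.
- exact/fin/measurableD.
- by move=> n; exact: measurableD.
- move=> m n mn; apply/subsetPset; apply: setDS => y /=; rewrite !in_itv/= !andbT.
  by apply: le_trans; rewrite lerD2l lef_pV2 ?posrE ?ltr0n// ler_nat.
- rewrite (_ : \bigcap_ _ _ = set0) ?measure0 ?lte_fin// -subset0 => y yD.
  have /= := (yD 0%N I).1; rewrite in_itv/= andbT -subr_gt0 => xy.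
  have [n _] := near_infty_natSinv_lt (PosNum xy).
  move=> /(_ n (leqnn n))/= ny; have [_] := yD n I; apply.
  by rewrite /= in_itv/= andbT -lerBrDl ltW.
- exists `[x + n.+1%:R^-1, +oo[%classic, `]x, +oo[%classic; split => //.
  + exact: interval_closed.
  + move=> y /=; rewrite !in_itv/= !andbT; apply: lt_le_trans.
    by rewrite ltrDl invr_gt0 ltr0n.
Qed.

(** The closed inner set is cut down to a large segment; as the segments exhaust the line, the mass
    lost tends to zero because [mu] is finite. *)
Lemma finite_measure_regular (R : realType)
    (mu : {measure set (measurableTypeR R) -> \bar R}) (A : set R) (e : R) :
  (mu setT < +oo)%E -> measurable A -> 0 < e ->
  exists K U : set R,
    [/\ compact K, open U, K `<=` A, A `<=` U & (mu (U `\` K) < e%:E)%E].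
Proof.
move=> muT mA e0.
have [F [U [cF oU FA AU UF]]] := finite_measure_closed_open muT mA e0.
pose B n : set R := `[- n%:R, n%:R]%classic.
have mU : measurable (U : set (measurableTypeR R)) by exact: open_measurable.
have mF : measurable (F : set (measurableTypeR R)) by exact: closed_measurable.
have mB n : measurable (B n : set (measurableTypeR R)) by exact: measurable_itv.
have mUFB n : measurable (U `\` (F `&` B n) : set (measurableTypeR R)).
  by apply: measurableD => //; exact: measurableI.
have [|//|||n Une] := @nonincreasing_measure_lt _ _ _ mu
    (fun n => U `\` (F `&` B n)) e%:E.
- by apply: le_lt_trans muT; apply: le_measure; rewrite ?inE.
- move=> m n mn; apply/subsetPset; apply: setDS; apply: setIS; rewrite /B => x /=.
  rewrite !in_itv/= => /andP[mx xm]; apply/andP; split.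
    by apply: le_trans mx; rewrite lerN2 ler_nat.
  by apply: (le_trans xm); rewrite ler_nat.
- rewrite (_ : \bigcap_ _ _ = U `\` F)//; apply/seteqP; split=> x.
    move=> Ux; split; first by case: (Ux 0%N I).
    move=> Fx; have [_] := Ux (Num.truncn `|x|).+1 I; apply; split=> //=.
    by rewrite /B /= in_itv/= -ler_norml ltW// truncnS_gt.
  by move=> [Ux nFx] n _; split => // -[].
- exists (F `&` B n), U; split => //.
    by rewrite setIC; apply: compact_closedI => //; exact: segment_compact.
  by move=> x [/FA].
Qed.

(** * Boxes *)

(* Same carrier as the product, but the measurable sets are only the boxes: the
   semiring to which Caratheodory's extension theorem is applied. *)
Definition box_space d1 d2 d3 (T1 : measurableType d1) (T2 : measurableType d2)
  (T3 : measurableType d3) : Type := (T1 * T2 * T3)%type.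

Section boxes.
Context d1 d2 d3 (T1 : measurableType d1) (T2 : measurableType d2)
  (T3 : measurableType d3).

Definition boxes : set (set (box_space T1 T2 T3)) :=
  [set X | exists A B C, [/\ measurable A, measurable B, measurable C &
    X = A `*` B `*` C]].

Lemma boxes0 : boxes set0.
Proof. by exists set0, set0, set0; split => //; rewrite !setX0. Qed.

Lemma boxesI : setI_closed boxes.
Proof.
move=> _ _ [A [B [C [mA mB mC ->]]]] [A' [B' [C' [mA' mB' mC' ->]]]].
exists (A `&` A'), (B `&` B'), (C `&` C'); split; try exact: measurableI.
by rewrite -!setXI.
Qed.

Lemma boxes_semi_setD : semi_setD_closed boxes.
Proof.
move=> _ _ [A [B [C [mA mB mC ->]]]] [A' [B' [C' [mA' mB' mC' ->]]]].
(* The difference is split according to the first coordinate that leaves the second box, which makes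
   the three pieces disjoint. *)
pose X := (A `\` A') `*` B `*` C.
pose Y := (A `&` A') `*` (B `\` B') `*` C.
pose Z := (A `&` A') `*` (B `&` B') `*` (C `\` C').
exists [set X; Y; Z]; split.
- by rewrite !finite_setU; do !split; exact: finite_set1.
- move=> _ [[->|->]|->].
  + by exists (A `\` A'), B, C; split => //; exact: measurableD.
  + exists (A `&` A'), (B `\` B'), C.
    by split => //; [exact: measurableI|exact: measurableD].
  + exists (A `&` A'), (B `&` B'), (C `\` C').
    by split => //; [exact: measurableI|exact: measurableI|exact: measurableD].
- rewrite !bigcup_setU !bigcup_set1; apply/seteqP; split => -[[x y] z] /=.
    move=> [[[Ax By] Cz] nXYZ].
    have [A'x|nA'x] := pselect (A' x); last by left; left.
    have [B'y|nB'y] := pselect (B' y); last by left; right.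
    by right; split => //; split => // C'z; apply: nXYZ.
  by move=> [[[[[? nA] ?] ?]|[[[? ?] [? nB]] ?]]|[[[? ?] [? ?]] [? nC]]];
    (split; first by []) => -[[? ?] ?]; [exact: nA|exact: nB|exact: nC].
- move=> U V UXYZ VXYZ [[[x y] z] [/= Ut Vt]].
  case: UXYZ VXYZ Ut Vt => [[->|->]|->] [[->|->]|->] //= ; rewrite /X /Y /Z /=; tauto.
Qed.

HB.instance Definition _ := Pointed.on (box_space T1 T2 T3).
HB.instance Definition _ := isSemiRingOfSets.Build default_measure_display
  (box_space T1 T2 T3) boxes0 boxesI boxes_semi_setD.

End boxes.

Section coordinates.
Variable R : realType.

Lemma measurable_departure : measurable_fun [set: time_space R] (@departure R).
Proof. by apply: measurableT_comp; [exact: measurable_fst|exact: measurable_fst]. Qed.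

Lemma measurable_crossing : measurable_fun [set: time_space R] (@crossing R).
Proof. by apply: measurableT_comp; [exact: measurable_snd|exact: measurable_fst]. Qed.

Lemma measurable_arrival : measurable_fun [set: time_space R] (@arrival R).
Proof. exact: measurable_snd. Qed.

Lemma measurable_departure_preimage (A : set (measurableTypeR R)) :
  measurable A -> measurable (@departure R @^-1` A).
Proof. by move=> mA; rewrite -[X in measurable X]setTI; exact: measurable_departure. Qed.

Lemma measurable_crossing_preimage (A : set (measurableTypeR R)) :
  measurable A -> measurable (@crossing R @^-1` A).
Proof. by move=> mA; rewrite -[X in measurable X]setTI; exact: measurable_crossing. Qed.

Lemma measurable_arrival_preimage (A : set (measurableTypeR R)) :
  measurable A -> measurable (@arrival R @^-1` A).
Proof. by move=> mA; rewrite -[X in measurable X]setTI; exact: measurable_arrival. Qed.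

Lemma measurable_box (A B C : set (measurableTypeR R)) :
  measurable A -> measurable B -> measurable C ->
  measurable (A `*` B `*` C : set (time_space R)).
Proof. by move=> mA mB mC; do 2?[apply: measurableX => //]. Qed.

Lemma open_box (A B C : set R) : open A -> open B -> open C ->
  open (A `*` B `*` C).
Proof.
move=> oA oB oC.
have fstc (T U : topologicalType) : continuous (@fst T U) by move=> x; exact: cvg_fst.
have sndc (T U : topologicalType) : continuous (@snd T U) by move=> x; exact: cvg_snd.
have oX (T U : topologicalType) (X : set T) (Y : set U) :
    open X -> open Y -> open (X `*` Y).
  move=> oX oY; rewrite (_ : X `*` Y = fst @^-1` X `&` snd @^-1` Y)//.
  by apply: openI; apply: open_comp => // x _; [exact: fstc|exact: sndc].
exact: oX (oX _ _ _ _ oA oB) oC.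
Qed.

End coordinates.

(** * Extension to a measure of a finitely additive function with dominated marginals *)

Section dominated_set_function.
Context {R : realType}.
Variables (nu0 nu1 nu2 : {measure set (measurableTypeR R) -> \bar R}).
Hypotheses (nu0T : (nu0 setT < +oo)%E) (nu1T : (nu1 setT < +oo)%E)
  (nu2T : (nu2 setT < +oo)%E).
Variable l : set (time_space R) -> R.
Hypotheses (l_ge0 : forall A, 0 <= l A)
  (l_add : forall A B, measurable A -> measurable B -> A `&` B = set0 ->
    l (A `|` B) = l A + l B).
Hypotheses
  (l_departure : forall A : set (measurableTypeR R), measurable A ->
    ((l (@departure R @^-1` A))%:E <= nu0 A)%E)
  (l_crossing : forall A : set (measurableTypeR R), measurable A ->
    ((l (@crossing R @^-1` A))%:E <= nu1 A)%E)
  (l_arrival : forall A : set (measurableTypeR R), measurable A ->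
    ((l (@arrival R @^-1` A))%:E <= nu2 A)%E).

Let l_set0 : l set0 = 0.
Proof.
have := l_add measurable0 measurable0 (setI0 _); rewrite setU0; lra.
Qed.

Let l_le A B : measurable A -> measurable B -> A `<=` B -> l A <= l B.
Proof.
move=> mA mB AB; rewrite -(setDUK AB) l_add ?lerDl//; first exact: measurableD.
exact: setDIK.
Qed.

Let l_U A B : measurable A -> measurable B -> l (A `|` B) <= l A + l B.
Proof.
move=> mA mB; have mAB : measurable ((A `|` B) `\` A).
  by apply: measurableD => //; exact: measurableU.
rewrite -(setDUK (@subsetUl _ A B)) l_add//; last exact: setDIK.
by rewrite lerD2l; apply: l_le => // x [[]].
Qed.

Let l_bigsetU (F : (set (time_space R))^nat) n : (forall i, measurable (F i)) ->
  l (\big[setU/set0]_(i < n) F i) <= \sum_(i < n) l (F i).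
Proof.
move=> mF; elim: n => [|n IH]; first by rewrite !big_ord0 l_set0.
rewrite !big_ord_recr/=; apply: le_trans (l_U _ _) _ => //.
  exact: bigsetU_measurable.
by rewrite lerD2r.
Qed.

Let l_trivIset (F : (set (time_space R))^nat) n : (forall i, measurable (F i)) ->
  trivIset setT F ->
  l (\big[setU/set0]_(i < n) F i) = \sum_(i < n) l (F i).
Proof.
move=> mF tF; elim: n => [|n IH]; first by rewrite !big_ord0 l_set0.
rewrite !big_ord_recr/= l_add ?IH//; first exact: bigsetU_measurable.
by apply: (@trivIset_bigsetUI _ xpredT) => //; exact: sub_trivIset tF.
Qed.

(** Each side is approximated with error [e / 3] for its own dominating measure. A point of the
    outer box outside the inner one has a coordinate in some [Ui] minus [Ki], and [l] of each such
    slab is bounded through the corresponding marginal. *)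
Lemma box_regular (A B C : set (measurableTypeR R)) (e : R) :
  measurable A -> measurable B -> measurable C -> 0 < e ->
  exists K U : set (R * R * R),
    [/\ compact K /\ measurable (K : set (time_space R)),
        open U /\ measurable (U : set (time_space R)),
        K `<=` A `*` B `*` C, A `*` B `*` C `<=` U & l U <= l K + e].
Proof.
move=> mA mB mC e0; have e3 : 0 < e / 3 by rewrite divr_gt0.
have [K0 [U0 [cK0 oU0 KA AU UK0]]] := finite_measure_regular nu0T mA e3.
have [K1 [U1 [cK1 oU1 KB BU UK1]]] := finite_measure_regular nu1T mB e3.
have [K2 [U2 [cK2 oU2 KC CU UK2]]] := finite_measure_regular nu2T mC e3.
have mU (V : set R) : open V -> measurable (V : set (measurableTypeR R)).
  by exact: open_measurable.
have mK (V : set R) : compact V -> measurable (V : set (measurableTypeR R)).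
  by exact: compact_measurable.
have mUK (V W : set R) : open V -> compact W ->
    measurable (V `\` W : set (measurableTypeR R)).
  by move=> oV cW; apply: measurableD; [exact: mU|exact: mK].
have mKK : measurable (K0 `*` K1 `*` K2 : set (time_space R)).
  by apply: measurable_box; exact: mK.
exists (K0 `*` K1 `*` K2), (U0 `*` U1 `*` U2); split.
- by split => //; do 2?[apply: compact_setX => //].
- by split; [exact: open_box|apply: measurable_box; exact: mU].
- by move=> [[x y] z] [[/= /KA ? /KB ?] /KC].
- by move=> [[x y] z] [[/= /AU ? /BU ?] /CU].
pose D0 := @departure R @^-1` (U0 `\` K0).
pose D1 := @crossing R @^-1` (U1 `\` K1).
pose D2 := @arrival R @^-1` (U2 `\` K2).
have mD0 : measurable D0 by apply: measurable_departure_preimage; exact: mUK.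
have mD1 : measurable D1 by apply: measurable_crossing_preimage; exact: mUK.
have mD2 : measurable D2 by apply: measurable_arrival_preimage; exact: mUK.
have l0 : l D0 <= e / 3.
  by rewrite -lee_fin; apply: (le_trans (l_departure (mUK _ _ oU0 cK0))); exact: ltW.
have l1 : l D1 <= e / 3.
  by rewrite -lee_fin; apply: (le_trans (l_crossing (mUK _ _ oU1 cK1))); exact: ltW.
have l2 : l D2 <= e / 3.
  by rewrite -lee_fin; apply: (le_trans (l_arrival (mUK _ _ oU2 cK2))); exact: ltW.
have mKD : measurable (K0 `*` K1 `*` K2 `|` D0 : set (time_space R)).
  exact: measurableU.
have mKDD : measurable (K0 `*` K1 `*` K2 `|` D0 `|` D1 : set (time_space R)).
  exact: measurableU.
apply: (@le_trans _ _ (l (K0 `*` K1 `*` K2 `|` D0 `|` D1 `|` D2))).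
  apply: l_le => //; [by apply: measurable_box; exact: mU|exact: measurableU|].
  move=> [[x y] z] [[/= Ux Uy] Uz].
  have [Kx|Kx] := pselect (K0 x); last by left; left; right.
  have [Ky|Ky] := pselect (K1 y); last by left; right.
  have [Kz|Kz] := pselect (K2 z); last by right.
  by left; left; left.
have := l_U mKDD mD2; have := l_U mKD mD1; have := l_U mKK mD0; lra.
Qed.

(** Compactness reduces countable covers to finite ones: a compact box inside [X], losing [e / 2],
    is covered by finitely many open enlargements of the [F n], whose excesses sum to at most
    [e / 2]. *)
Lemma box_sigma_subadditive (X : set (time_space R))
    (F : (set (time_space R))^nat) :
  (forall n, boxes (F n)) -> boxes X -> X `<=` \bigcup_n F n ->
  ((l X)%:E <= \sum_(n <oo) (l (F n))%:E)%E.
Proof.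
move=> bF [A [B [C [mA mB mC XE]]]] XF.
apply/lee_addgt0Pr => e e0.
have e2 : 0 < e / 2 by rewrite divr_gt0.
have e4 n : 0 < e / 2 / (2 ^ n.+1)%:R by rewrite !divr_gt0// ltr0n expn_gt0.
have [K [U [[cK mK] [oU mU] KX XU UK]]] := box_regular mA mB mC e2.
have /choice[V VP] n : exists V : set (R * R * R), [/\ open V,
    measurable (V : set (time_space R)), F n `<=` V &
    l V <= l (F n) + e / 2 / (2 ^ n.+1)%:R].
  have [A' [B' [C' [mA' mB' mC' FE]]]] := bF n.
  have [K' [U' [[cK' mK'] [oU' mU'] KX' XU' UK']]] :=
    box_regular mA' mB' mC' (e4 n).
  exists U'; split => //; rewrite FE//; apply: (le_trans UK').
  by rewrite lerD2r; apply: l_le => //; exact: measurable_box.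
have mV n : measurable (V n : set (time_space R)) by case: (VP n).
have [N KN] : exists N, K `<=` \big[setU/set0]_(i < N) V i.
  (* Around each point of [K] a neighbourhood lies in the partial unions for all large [N];
     compactness makes [N] uniform. *)
  have ncK := iffLR (compact_near_coveringP _) cK.
  apply: (@filter_ex _ \oo).
  apply: (ncK nat \oo (fun N t => (\big[setU/set0]_(i < N) V i) t)) => t /KX Kt.
  have [n _ Fnt] : (\bigcup_n F n) t by apply: XF; rewrite XE.
  have [oV _ FV _] := VP n.
  exists (V n, [set N | (n < N)%N]).
    by split; [exact: open_nbhs_nbhs (conj oV (FV _ Fnt))|exists n.+1].
  by move=> [u N] [/= Vu nN]; rewrite -bigcup_mkord; exists n.
have XK : l X <= l K + e / 2.
  by apply: le_trans UK; apply: l_le => //; rewrite XE//; exact: measurable_box.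
have KV : l K <= \sum_(i < N) (l (F i) + e / 2 / (2 ^ i.+1)%:R).
  apply: (@le_trans _ _ (l (\big[setU/set0]_(i < N) V i))).
    by apply: l_le => //; exact: bigsetU_measurable.
  apply: (le_trans (l_bigsetU _ mV)).
  by apply: ler_sum => i _; case: (VP i).
apply: (@le_trans _ _ (\sum_(n <oo) (l (F n))%:E + (e / 2)%:E + (e / 2)%:E)%E); last first.
  by rewrite -addeA -EFinD -splitr.
apply: (@le_trans _ _ ((l K)%:E + (e / 2)%:E)%E); first by rewrite -EFinD lee_fin.
apply: leeD2r; apply: le_trans (epsilon_trick xpredT _ (ltW e2)); last first.
  by move=> n; rewrite lee_fin.
apply: le_trans (nneseries_lim_ge N _); last first.
  by move=> n _ _; rewrite -EFinD lee_fin addr_ge0// ltW.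
by rewrite big_mkord; under eq_bigr do rewrite -EFinD; rewrite sumEFin lee_fin.
Qed.

Let boxes_measurable (X : set (time_space R)) : boxes X -> measurable X.
Proof. by move=> [A [B [C [mA mB mC ->]]]]; exact: measurable_box. Qed.

Let T3 := box_space (measurableTypeR R) (measurableTypeR R) (measurableTypeR R).

Let box_content : set T3 -> \bar R := fun X => (l X)%:E.

Let box_content_ge0 X : (0 <= box_content X)%E.
Proof. by rewrite lee_fin. Qed.

Let box_content_semi_additive : measure_function.semi_additive box_content.
Proof.
move=> F n mF tF _; rewrite /box_content l_trivIset//; last first.
  by move=> i; exact: (boxes_measurable (mF i)).
by rewrite sumEFin.
Qed.

HB.instance Definition _ := isContent.Build _ T3 R box_content
  box_content_ge0 box_content_semi_additive.

Let box_content_sigma_subadditive : measurable_subset_sigma_subadditive box_content.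
Proof. by move=> X F mF mX XF; exact: box_sigma_subadditive. Qed.

HB.instance Definition _ := Content_SigmaSubAdditive_isMeasure.Build _ _ _
  box_content box_content_sigma_subadditive.

(** Caratheodory's extension lives on the sigma-algebra generated by the boxes. Pushing it forward
    by the identity carries it to the product sigma-algebra, whose three coordinate maps are
    measurable because their preimages are boxes. *)
Lemma box_measure_extension : exists pi : {measure set (time_space R) -> \bar R},
  forall A B C : set (measurableTypeR R),
    measurable A -> measurable B -> measurable C ->
    pi (A `*` B `*` C) = (l (A `*` B `*` C))%:E.
Proof.
pose ext : {measure set (g_sigma_algebraType (@measurable _ T3)) -> \bar R} :=
  measure_extension box_content.
pose f : g_sigma_algebraType (@measurable _ T3) -> time_space R := id.
have mf : measurable_fun setT f.
  have sG : @measurable _ T3 `<=` (@measurable _ T3).-sigma.-measurable.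
    exact: sub_sigma_algebra.
  apply/measurable_fun_pairP; split; [apply/measurable_fun_pairP; split|].
  - move=> _ A mA; apply: sG; exists A, setT, setT; split => //.
    by apply/seteqP; split => -[[x y] z] //= [] // [].
  - move=> _ A mA; apply: sG; exists setT, A, setT; split => //.
    by apply/seteqP; split => -[[x y] z] //= [] // [].
  - move=> _ A mA; apply: sG; exists setT, setT, A; split => //.
    by apply/seteqP; split => -[[x y] z] //= [] // [].
(* The measure structure of a pushforward depends on [mf], hence is not
   inferred from the term [pushforward ext f]. *)
pose pi : {measure set (time_space R) -> \bar R} :=
  measure_function_pushforward__canonical__measure_function_Measure ext mf.
exists pi => A B C mA mB mC.
by apply: (measurable_mu_extE box_content); exists A, B, C.
Qed.

End dominated_set_function.

(** * Limits along an ultrafilter *)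

(** Compactness of the segment gives a cluster point, and a cluster point of an ultrafilter is a
    limit. *)
Lemma ultrafilter_segment_cvg (R : realType) T (U : set_system T) (f : T -> R)
    (a b : R) : UltraFilter U -> (forall t, a <= f t <= b) ->
  exists2 l, a <= l & f @ U --> l.
Proof.
move=> UU fab.
have fU : (f @ U) `[a, b]%classic.
  by apply: (@filterE _ U) => t /=; rewrite in_itv/=.
have [l [lab lU]] := segment_compact (fmap_proper_filter f _) fU.
exists l => [|V lV]; first by move: lab; rewrite /= in_itv/= => /andP[].
have [//|UV] := in_ultra_setVsetC (f @^-1` V) UU.
by have [x [nVx /nVx]] := lU (~` V) V UV lV.
Qed.

Section box_limit.
Context {R : realType}.
Variables (nu0 nu1 nu2 : {measure set (measurableTypeR R) -> \bar R}).
Hypotheses (nu0T : (nu0 setT < +oo)%E) (nu1T : (nu1 setT < +oo)%E)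
  (nu2T : (nu2 setT < +oo)%E).
Variable pi_ : nat -> {measure set (time_space R) -> \bar R}.
Hypotheses
  (pi_departure : forall n (A : set (measurableTypeR R)), measurable A ->
    (pi_ n (@departure R @^-1` A) <= nu0 A)%E)
  (pi_crossing : forall n (A : set (measurableTypeR R)), measurable A ->
    (pi_ n (@crossing R @^-1` A) <= nu1 A)%E)
  (pi_arrival : forall n (A : set (measurableTypeR R)), measurable A ->
    (pi_ n (@arrival R @^-1` A) <= nu2 A)%E).

Let pi_le n A : measurable A -> (pi_ n A <= nu0 setT)%E.
Proof.
move=> mA; apply: le_trans (pi_departure n measurableT).
by apply: le_measure; rewrite ?inE//; exact: measurable_departure_preimage.
Qed.

Let pi_fin n A : measurable A -> pi_ n A \is a fin_num.
Proof.
by move=> mA; rewrite ge0_fin_numE//; exact: le_lt_trans (pi_le n mA) nu0T.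
Qed.

(** A single ultrafilter serves all measurable sets at once, although there are uncountably many of
    them. Additivity and the marginal bounds pass to the limit, so the extension result applies. *)
Lemma box_limit : exists (U : set_system nat)
    (pi : {measure set (time_space R) -> \bar R}),
  [/\ ProperFilter U, \oo `<=` U &
    forall A B C : set (measurableTypeR R),
      measurable A -> measurable B -> measurable C ->
      pi (A `*` B `*` C) \is a fin_num /\
      fine (pi_ n (A `*` B `*` C)) @[n --> U] --> fine (pi (A `*` B `*` C))].
Proof.
have [U [UU ooU]] := @ultraFilterLemma nat \oo _.
have PU : ProperFilter U by exact: ultra_proper.
(* The default value 0 on non-measurable sets makes [l] total and nonnegative everywhere. *)
have /choice[l lP] (A : set (time_space R)) : exists l : R, 0 <= l /\
    (measurable A -> fine (pi_ n A) @[n --> U] --> l).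
  have [mA|nmA] := pselect (measurable A); last by exists 0.
  have [n|l l0 lU] := @ultrafilter_segment_cvg R _ U (fun n => fine (pi_ n A))
      0 (fine (nu0 setT)) UU.
    rewrite fine_ge0//= fine_le//; [exact: pi_fin| |exact: pi_le].
    by rewrite ge0_fin_numE.
  by exists l.
have l0 A : 0 <= l A by case: (lP A).
have lU A : measurable A -> fine (pi_ n A) @[n --> U] --> l A by case: (lP A).
have l_le (mu : {measure set (measurableTypeR R) -> \bar R})
    (f : time_space R -> measurableTypeR R) :
    (mu setT < +oo)%E ->
    (forall A : set (measurableTypeR R), measurable A -> measurable (f @^-1` A)) ->
    (forall n (A : set (measurableTypeR R)), measurable A ->
      (pi_ n (f @^-1` A) <= mu A)%E) ->
    forall A : set (measurableTypeR R), measurable A ->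
      ((l (f @^-1` A))%:E <= mu A)%E.
  move=> muT mf pif A mA; have muA : mu A \is a fin_num.
    rewrite ge0_fin_numE//; apply: le_lt_trans muT.
    by apply: le_measure; rewrite ?inE.
  rewrite -(fineK muA) lee_fin.
  apply: (ler_cvg_to (lU _ (mf _ mA)) (cvg_cst _)); apply: nearW => n.
  by rewrite fine_le//; [exact: (pi_fin _ (mf _ mA))|exact: pif].
have l_add A B : measurable A -> measurable B -> A `&` B = set0 ->
    l (A `|` B) = l A + l B.
  move=> mA mB AB.
  apply: (cvg_unique (@Rhausdorff R) (lU _ (measurableU _ _ mA mB))).
  rewrite (_ : (fun n => fine (pi_ n (A `|` B))) =
    (fun n => fine (pi_ n A)) + (fun n => fine (pi_ n B))).
    exact: cvgD (lU _ mA) (lU _ mB).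
  by apply/funext => n /=; rewrite measureU// fineD ?pi_fin.
have [pi piE] := box_measure_extension nu0T nu1T nu2T l0 l_add
  (l_le _ _ nu0T (@measurable_departure_preimage R) pi_departure)
  (l_le _ _ nu1T (@measurable_crossing_preimage R) pi_crossing)
  (l_le _ _ nu2T (@measurable_arrival_preimage R) pi_arrival).
exists U, pi; split => // A B C mA mB mC; rewrite piE//; split => //.
exact: (lU _ (measurable_box mA mB mC)).
Qed.

End box_limit.

(** * Lower semicontinuity of the cost *)

Section grid_lower_bound.
Context {R : realType}.
Definition grid_index (k : nat) (x : R) : nat := Num.truncn (k.+1%:R * x).

(* From cell [i] to a cell [j >= i] of the grid of mesh [1 / k.+1] the travel
   time is at most [(j - i).+1 / k.+1]; truncated subtraction makes the bound
   blow up with [k] when [j <= i]. *)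
Definition edge_lb (w : R) (k i j : nat) : R := w * k.+1%:R / (j - i).+1%:R.

Lemma edge_lb_ge0 w k i j : 0 < w -> 0 <= edge_lb w k i j.
Proof. by move=> w0; rewrite !mulr_ge0 ?invr_ge0// ltW. Qed.

Lemma edge_lb_le w k (x y : R) : 0 < w -> 0 <= x -> x < y ->
  edge_lb w k (grid_index k x) (grid_index k y) <= w / (y - x).
Proof.
move=> w0 x0 xy; have y0 : 0 <= y by rewrite ltW// (le_lt_trans x0).
have K0 : (0 : R) < k.+1%:R by rewrite ltr0n.
have ij : (grid_index k x <= grid_index k y)%N.
  by rewrite le_truncn// ler_pM2l// ltW.
rewrite /edge_lb -mulrA ler_pM2l// ler_pdivrMr// ler_pdivlMl ?subr_gt0//.
rewrite -[(_ - _).+1%:R]natr1 natrB//.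
have /andP[_] := truncn_itv (mulr_ge0 (ltW K0) y0).
have /andP[+ _] := truncn_itv (mulr_ge0 (ltW K0) x0).
rewrite -/(grid_index k x) -/(grid_index k y) -[(grid_index k _).+1%:R]natr1.
rewrite mulrBl ![_ * k.+1%:R]mulrC.
lra.
Qed.

(** Rounding both endpoints to the grid overestimates the travel time by at most two mesh widths. *)
Lemma edge_lb_ge w k (x y : R) : 0 < w -> 0 <= x -> x < y ->
  w / (y - x + 2 * k.+1%:R^-1) <= edge_lb w k (grid_index k x) (grid_index k y).
Proof.
move=> w0 x0 xy; have y0 : 0 <= y by rewrite ltW// (le_lt_trans x0).
have K0 : (0 : R) < k.+1%:R by rewrite ltr0n.
have ij : (grid_index k x <= grid_index k y)%N.
  by rewrite le_truncn// ler_pM2l// ltW.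
have yxK : 0 < y - x + 2 * k.+1%:R^-1.
  by rewrite addr_gt0 ?subr_gt0// mulr_gt0// invr_gt0.
rewrite /edge_lb -mulrA ler_pM2l// ler_pdivlMr// mulrC ler_pdivrMr//.
rewrite -[(_ - _).+1%:R]natr1 natrB//.
have /andP[+ _] := truncn_itv (mulr_ge0 (ltW K0) y0).
have /andP[_] := truncn_itv (mulr_ge0 (ltW K0) x0).
rewrite -/(grid_index k x) -/(grid_index k y) -[(grid_index k _).+1%:R]natr1.
rewrite mulrDr mulrBr.
rewrite [k.+1%:R * (2 * _)]mulrCA mulfV ?gt_eqF//.
lra.
Qed.

Lemma edge_lb_cvg w (x y : R) : 0 < w -> 0 <= x -> x < y ->
  edge_lb w k (grid_index k x) (grid_index k y) @[k --> \oo] --> w / (y - x).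
Proof.
move=> w0 x0 xy; 
apply: (@squeeze_cvgr _ _ _ _ (fun k => w / (y - x + 2 * k.+1%:R^-1))
  (fun=> w / (y - x))); last exact: cvg_cst.
  by apply: nearW => k; rewrite edge_lb_ge//= edge_lb_le.
apply: cvgMr; apply: cvgV; first by rewrite subr_eq0 gt_eqF.
rewrite -[X in _ --> X]addr0; apply: cvgD; first exact: cvg_cst.
by rewrite -(mulr0 2); apply: cvgMr; exact: cvg_harmonic.
Qed.

Lemma edge_lb_pinfty w (x y : R) : 0 < w -> y <= x ->
  edge_lb w k (grid_index k x) (grid_index k y) @[k --> \oo] --> +oo.
Proof.
move=> w0 yx; apply/cvgryPge => A.
have ji k : (grid_index k y - grid_index k x = 0)%N.
  by apply/eqP; rewrite subn_eq0 le_truncn// ler_pM2l.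
(* With index difference 0 the bound is [w * k.+1%:R], which exceeds [A] as soon as [k.+1] exceeds
   [A / w]. *)
exists (Num.truncn (A / w)) => // k /= Ak.
rewrite /edge_lb ji divr1 -ler_pdivrMl// mulrC ltW// (lt_le_trans (truncnS_gt _))//.
by rewrite ler_nat.
Qed.

End grid_lower_bound.

(** * Step functions below the cost, and semicontinuity of the total cost *)

Section step_cost.
Context {R : realType}.
Variables (tf w01 w12 : R).
Hypotheses (w01_gt0 : 0 < w01) (w12_gt0 : 0 < w12).

(** Half-open cells, so that every time in the horizon belongs to exactly one of them. *)
Definition grid_cell (k i : nat) : set (measurableTypeR R) :=
  horizon tf `&` `[i%:R / k.+1%:R, i.+1%:R / k.+1%:R[%classic.

Lemma measurable_grid_cell k i : measurable (grid_cell k i).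
Proof. by apply: measurableI; exact: measurable_itv. Qed.

Lemma grid_cellP k i (x : R) : horizon tf x ->
  grid_cell k i x <-> grid_index k x = i.
Proof.
move=> Hx; have K0 : (0 : R) < k.+1%:R by rewrite ltr0n.
have x0 : 0 <= x by move: Hx; rewrite /horizon /= in_itv/= => /andP[].
rewrite /grid_cell /= in_itv/= ler_pdivrMr// ltr_pdivlMr// mulrC -truncn_eq.
  by split => [[_ /eqP]|/eqP].
by rewrite mulr_ge0.
Qed.

Definition grid_box k (q : nat * nat * nat) : set (time_space R) :=
  grid_cell k q.1.1 `*` grid_cell k q.1.2 `*` grid_cell k q.2.

Lemma measurable_grid_box k q : measurable (grid_box k q).
Proof. by apply: measurable_box; exact: measurable_grid_cell. Qed.

Lemma grid_box_cube k q : grid_box k q `<=` time_cube tf.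
Proof. by move=> [[x y] z] [[[? _] [? _]] [? _]]. Qed.

Definition cost_lb k (q : nat * nat * nat) : R :=
  edge_lb w01 k q.1.1 q.1.2 + edge_lb w12 k q.1.2 q.2.

Lemma cost_lb_ge0 k q : 0 <= cost_lb k q.
Proof. by rewrite addr_ge0 ?edge_lb_ge0. Qed.

(** The [.+1] includes the cell that contains the right endpoint [tf]. *)
Definition grid_seq k : seq (nat * nat * nat) :=
  let s := iota 0 (grid_index k tf).+1 in
  [seq (p, m) | p <- [seq (i, j) | i <- s, j <- s], m <- s].

(** Written with box indicators, so that its integral is a finite combination of box masses, the
    only quantities known to converge. *)
Definition step_cost k (t : time_space R) : R :=
  \sum_(q <- grid_seq k) cost_lb k q * \1_(grid_box k q) t.

Definition grid_point k (t : time_space R) : nat * nat * nat :=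
  (grid_index k (departure t), grid_index k (crossing t),
   grid_index k (arrival t)).

Lemma grid_seq_uniq k : uniq (grid_seq k).
Proof. by rewrite /grid_seq !allpairs_uniq ?iota_uniq// => -[? ?] []. Qed.

Lemma grid_point_seq k t : time_cube tf t -> grid_point k t \in grid_seq k.
Proof.
have H x : horizon tf x -> grid_index k x \in iota 0 (grid_index k tf).+1.
  move=> Hx; have xtf : x <= tf.
    by move: Hx; rewrite /horizon /= in_itv/= => /andP[].
  by rewrite mem_iota/= ltnS le_truncn// ler_pM2l.
move: t => [[x y] z] [[/= Hx Hy] Hz].
rewrite /grid_seq /grid_point.
apply: (allpairs_f pair); last exact: H.
by apply: (allpairs_f pair); exact: H.
Qed.

Lemma grid_boxP k q t : time_cube tf t -> grid_box k q t <-> grid_point k t = q.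
Proof.
move: t q => [[x y] z] [[i j] m] [[/= Hx Hy] Hz]; split.
  move=> [[/= /grid_cellP ix /grid_cellP jy] /grid_cellP mz].
  by rewrite /grid_point /departure /crossing /arrival /= ix// jy// mz.
by case=> ix jy mz; split; [split|]; apply/grid_cellP.
Qed.

Lemma step_costE k t : time_cube tf t ->
  step_cost k t = cost_lb k (grid_point k t).
Proof.
move=> tt; rewrite /step_cost (bigD1_seq (grid_point k t)) ?grid_point_seq//=; last first.
  exact: grid_seq_uniq.
rewrite indicE mem_set; last exact/grid_boxP.
rewrite mulr1 big1 ?addr0// => q /eqP qt.
by rewrite indicE memNset ?mulr0// => /(grid_boxP _ _ tt) /esym.
Qed.

Lemma step_cost_ge0 k t : 0 <= step_cost k t.
Proof. by rewrite sumr_ge0// => q _; rewrite mulr_ge0 ?cost_lb_ge0. Qed.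

Lemma measurable_step_cost k :
  measurable_fun (time_cube tf) (EFin \o step_cost k).
Proof.
apply/measurable_EFinP; apply: measurable_funTS.
apply: measurable_sum => q; apply: measurable_funM => //.
by apply/measurable_indicP; exact: measurable_grid_box.
Qed.

Lemma step_cost_le k t : time_cube tf t ->
  ((step_cost k t)%:E <= transport_cost w01 w12 t)%E.
Proof.
move=> tt; rewrite step_costE//; move: t tt => [[x y] z] [[/= Hx Hy] Hz].
rewrite /transport_cost /departure /crossing /arrival /=.
case: ifPn => [/andP[xy yz]|_]; last exact: leey.
move: Hx Hy; rewrite /horizon /= !in_itv/= => /andP[x0 _] /andP[y0 _].
by rewrite lee_fin lerD ?edge_lb_le.
Qed.

Lemma step_cost_cvg t : time_cube tf t ->
  (step_cost k t)%:E @[k --> \oo] --> transport_cost w01 w12 t.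
Proof.
move=> tt; under eq_fun do rewrite step_costE//.
move: t tt => [[x y] z] [[/= Hx Hy] Hz].
rewrite /transport_cost /departure /crossing /arrival /= /cost_lb /=.
move: Hx Hy; rewrite /horizon /= !in_itv/= => /andP[x0 _] /andP[y0 _].
case: ifPn => [/andP[xy yz]|].
  by apply: cvg_EFin; [exact: nearW|apply: cvgD; exact: edge_lb_cvg].
(* For unordered times one edge bound tends to infinity while the other stays nonnegative. *)
rewrite negb_and -!leNgt => /orP[yx|zy]; apply/cvgeryP.
  apply: ger_cvgy (edge_lb_pinfty w01_gt0 yx).
  by apply: nearW => k; rewrite lerDl edge_lb_ge0.
apply: ger_cvgy (edge_lb_pinfty w12_gt0 zy).
by apply: nearW => k; rewrite lerDr edge_lb_ge0.
Qed.

Lemma measurable_time_cube : measurable (time_cube tf).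
Proof. by apply: measurable_box; exact: measurable_itv. Qed.

Lemma measurable_transport_cost :
  measurable_fun (time_cube tf) (transport_cost w01 w12).
Proof.
apply: (emeasurable_fun_cvg (fun k => EFin \o step_cost k)).
  exact: measurable_step_cost.
exact: step_cost_cvg.
Qed.

Lemma integral_step_cost k (pi : {measure set (time_space R) -> \bar R}) :
  (forall A B C : set (measurableTypeR R),
    measurable A -> measurable B -> measurable C ->
    pi (A `*` B `*` C) \is a fin_num) ->
  (\int[pi]_(t in time_cube tf) (step_cost k t)%:E =
   (\sum_(q <- grid_seq k) cost_lb k q * fine (pi (grid_box k q)))%:E)%E.
Proof.
move=> pifin; have mcube := measurable_time_cube.
under eq_integral do rewrite /step_cost -sumEFin.
rewrite ge0_integral_sum//; last 2 first.
- move=> q; apply/measurable_EFinP; apply: measurable_funTS; apply: measurable_funM => //.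
  by apply/measurable_indicP; exact: measurable_grid_box.
- by move=> q t _; rewrite lee_fin mulr_ge0 ?cost_lb_ge0.
rewrite -sumEFin; apply: eq_bigr => q _.
under eq_integral do rewrite EFinM.
rewrite ge0_integralZl_EFin ?cost_lb_ge0//; last first.
  apply/measurable_EFinP; apply: measurable_funTS.
  by apply/measurable_indicP; exact: measurable_grid_box.
rewrite integral_indic//; last exact: measurable_grid_box.
rewrite (setIidl (@grid_box_cube _ _)) EFinM fineK//.
by apply: pifin; exact: measurable_grid_cell.
Qed.

Lemma total_cost_lsc (U : set_system nat) (I : R)
    (pi : {measure set (time_space R) -> \bar R})
    (pi_ : nat -> {measure set (time_space R) -> \bar R}) :
  ProperFilter U -> \oo `<=` U ->
  (forall A B C : set (measurableTypeR R),
    measurable A -> measurable B -> measurable C ->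
    pi (A `*` B `*` C) \is a fin_num) ->
  (forall n (A B C : set (measurableTypeR R)),
    measurable A -> measurable B -> measurable C ->
    pi_ n (A `*` B `*` C) \is a fin_num) ->
  (forall A B C : set (measurableTypeR R),
    measurable A -> measurable B -> measurable C ->
    fine (pi_ n (A `*` B `*` C)) @[n --> U] --> fine (pi (A `*` B `*` C))) ->
  (forall n, (total_cost tf w01 w12 (pi_ n) <= (I + n.+1%:R^-1)%:E)%E) ->
  (total_cost tf w01 w12 pi <= I%:E)%E.
Proof.
move=> PU ooU pifin pinfin cpi pin.
have mcube := measurable_time_cube.
(* The grid level [k] is fixed while [n] runs along [U]; refining the grid comes afterwards, by
   Fatou under [pi] alone. *)
have stepI k : (\int[pi]_(t in time_cube tf) (step_cost k t)%:E <= I%:E)%E.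
  rewrite integral_step_cost// lee_fin.
  have cI : I + n.+1%:R^-1 @[n --> U] --> I.
    rewrite -[X in _ --> X]addr0; apply: cvgD; first exact: cvg_cst.
    by move=> V /(@cvg_harmonic R)/ooU.
  apply: (ler_cvg_to _ cI).
    apply: cvg_big => [|q _]; first exact: add_continuous.
    by apply: cvgMr; apply: cpi; exact: measurable_grid_cell.
  apply: nearW => n; rewrite -lee_fin -integral_step_cost//; last exact: pinfin.
  apply: le_trans (pin n); apply: ge0_le_integral => //.
  - by move=> t _; rewrite lee_fin step_cost_ge0.
  - exact: measurable_step_cost.
  - exact: measurable_transport_cost.
  - by move=> t tt; exact: step_cost_le.
rewrite /total_cost.
rewrite (eq_integral (fun t => limn_einf (fun k => (step_cost k t)%:E))); last first.
  by move=> t /set_mem tt; rewrite (cvg_limn_einf_sup (step_cost_cvg tt)).1.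
apply: (le_trans (fatou pi mcube measurable_step_cost _)).
  by move=> k t _; rewrite lee_fin step_cost_ge0.
rewrite limn_einf_lim; apply: lime_le; first exact: is_cvg_einfs.
apply: nearW => k; apply: le_trans (stepI k).
by apply: ereal_inf_lbound; exists k => //=.
Qed.

End step_cost.

(** * Feasible plans *)

Section feasibility.
Context {R : realType}.
Implicit Types (pi : {measure set (time_space R) -> \bar R}).

Lemma departure_preimageE (A : set (measurableTypeR R)) :
  @departure R @^-1` A = A `*` setT `*` setT.
Proof. by apply/seteqP; split => -[[x y] z] //= -[] []. Qed.

Lemma crossing_preimageE (A : set (measurableTypeR R)) :
  @crossing R @^-1` A = setT `*` A `*` setT.
Proof. by apply/seteqP; split => -[[x y] z] //= -[] []. Qed.

Lemma arrival_preimageE (A : set (measurableTypeR R)) :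
  @arrival R @^-1` A = setT `*` setT `*` A.
Proof. by apply/seteqP; split => -[[x y] z] //= -[] []. Qed.

Lemma measurable_horizon (tf : R) : measurable (horizon tf).
Proof. exact: measurable_itv. Qed.

(** The complement of the cube is covered by the three slabs in which one coordinate leaves the
    horizon. *)
Lemma concentrated_on_time_cube (tf : R) pi :
  pi (@departure R @^-1` (~` horizon tf)) = 0%E ->
  pi (@crossing R @^-1` (~` horizon tf)) = 0%E ->
  pi (@arrival R @^-1` (~` horizon tf)) = 0%E ->
  concentrated_on pi (time_cube tf).
Proof.
move=> pi0 pi1 pi2.
have mHC : measurable (~` horizon tf) by apply: measurableC; exact: measurable_horizon.
have m0 := measurable_departure_preimage mHC.
have m1 := measurable_crossing_preimage mHC.
have m2 := measurable_arrival_preimage mHC.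
have m01 := measurableU _ _ m0 m1.
have pi01 : pi (@departure R @^-1` (~` horizon tf) `|`
    @crossing R @^-1` (~` horizon tf)) = 0%E by exact: null_set_setU.
have pi012 := null_set_setU m01 m2 pi01 pi2.
apply/eqP; rewrite -measure_le0 -pi012; apply: le_measure; rewrite ?inE.
- by apply: measurableC; exact: measurable_time_cube.
- exact: measurableU.
- move=> [[x y] z] /= nxyz.
  have [Hx|] := pselect (horizon tf x); last by left; left.
  have [Hy|] := pselect (horizon tf y); last by left; right.
  by right => Hz; apply: nxyz.
Qed.

(** Allows [r] times Lebesgue measure, which is infinite on the line for positive [r], to be
    replaced by its finite restriction, as regularity requires. Outside the cube [pi] has no
    mass. *)
Lemma crossing_le_restr (tf : R) pi
    (nu : {measure set (measurableTypeR R) -> \bar R}) :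
  concentrated_on pi (time_cube tf) ->
  (forall A : set (measurableTypeR R), measurable A ->
    (pi (@crossing R @^-1` A) <= nu A)%E) ->
  forall A : set (measurableTypeR R), measurable A ->
    (pi (@crossing R @^-1` A) <= mrestr nu (measurable_horizon tf) A)%E.
Proof.
move=> piC pinu A mA; have mAH : measurable (A `&` horizon tf).
  by apply: measurableI => //; exact: measurable_horizon.
apply: le_trans (pinu _ mAH).
have mcube := measurable_time_cube tf.
have mC := measurableC mcube.
have mAp := measurable_crossing_preimage mA.
have mAHp := measurable_crossing_preimage mAH.
apply: (@le_trans _ _ (pi (@crossing R @^-1` (A `&` horizon tf) `|`
    ~` time_cube tf))).
  apply: le_measure; rewrite ?inE//; first exact: measurableU.
  move=> [[x y] z] /= Ay.
  have [Hxyz|] := pselect (time_cube tf (x, y, z)); last by right.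
  by left; split => //; case: Hxyz => -[].
by rewrite measureU0.
Qed.

Variables (tf r : R) (mu0 muT : probability (measurableTypeR R) R).
Hypotheses (tf_gt0 : 0 < tf) (mu0H : concentrated_on mu0 (horizon tf))
  (muTH : concentrated_on muT (horizon tf)).

Lemma lebesgue_measure_horizon : lebesgue_measure (horizon tf) = tf%:E.
Proof. by rewrite /horizon lebesgue_measure_itv /= lte_fin tf_gt0 -EFinB subr0. Qed.

(** The uniform crossing law has density [tf^-1]. Feasibility does not ask for ordered times, so
    this plan may well have infinite cost. *)
Lemma feasible_exists : tf^-1 <= r -> exists pi, feasible tf r mu0 muT pi.
Proof.
move=> tfr; have c0 : 0 <= tf^-1 by rewrite invr_ge0 ltW.
pose leb : {measure set (measurableTypeR R) -> \bar R} := @lebesgue_measure R.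
pose unif : {measure set (measurableTypeR R) -> \bar R} :=
  mscale (NngNum c0) (mrestr leb (measurable_horizon tf)).
have unifE A : unif A = (tf^-1%:E * leb (A `&` horizon tf))%E by [].
have unifT : unif setT = 1%E.
  rewrite unifE setTI (_ : leb _ = tf%:E); last exact: lebesgue_measure_horizon.
  by rewrite -EFinM mulVf ?gt_eqF.
(* In both products the sections are measured by a probability, [mu0] for the inner one and [muT]
   for the outer one. *)
pose pi : {measure set (time_space R) -> \bar R} := ((mu0 \x^ unif) \x muT)%E.
have piE (A B C : set (measurableTypeR R)) :
    measurable A -> measurable B -> measurable C ->
    pi (A `*` B `*` C) = (mu0 A * unif B * muT C)%E.
  move=> mA mB mC; transitivity ((mu0 \x^ unif) (A `*` B) * muT C)%E.
    by apply: product_measure1E => //; exact: measurableX.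
  by congr (_ * _)%E; exact: product_measure2E.
have pid (A : set (measurableTypeR R)) : measurable A ->
    pi (@departure R @^-1` A) = mu0 A.
  by move=> mA; rewrite departure_preimageE piE// unifT probability_setT !mule1.
have pic (A : set (measurableTypeR R)) : measurable A ->
    pi (@crossing R @^-1` A) = unif A.
  by move=> mA; rewrite crossing_preimageE piE// !probability_setT mule1 mul1e.
have pia (A : set (measurableTypeR R)) : measurable A ->
    pi (@arrival R @^-1` A) = muT A.
  by move=> mA; rewrite arrival_preimageE piE// unifT probability_setT !mul1e.
have mHC : measurable (~` horizon tf) by apply: measurableC; exact: measurable_horizon.
exists pi; split => //.
- apply: concentrated_on_time_cube; rewrite ?pid ?pic ?pia//.
  by rewrite unifE setICl measure0 mule0.
- move=> A mA; rewrite /pushforward pic// unifE.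
  apply: lee_pmul => //.
  apply: le_measure; rewrite ?inE//.
  by apply: measurableI => //; exact: measurable_horizon.
Qed.

End feasibility.

(** * Minimizing sequence and passage to the limit *)

Theorem proposition1 (R : realType) (tf w01 w12 : R)
    (mu0 muT : probability (measurableTypeR R) R)
    (htf : 0 < tf) (hw01 : 0 < w01) (hw12 : 0 < w12)
    (hmu0 : concentrated_on mu0 (horizon tf))
    (hmuT : concentrated_on muT (horizon tf)) :
  exists2 r0 : R, 0 < r0 &
    forall r : R, r0 <= r ->
      exists pi : {measure set (time_space R) -> \bar R},
        minimizer tf w01 w12 r mu0 muT pi.
Proof.
(* This threshold is sharp for feasibility: a unit mass crossing within the horizon forces
   [1 <= r * tf]. *)
exists tf^-1; first by rewrite invr_gt0.
move=> r tfr; have r0 : 0 <= r by rewrite (le_trans _ tfr)// invr_ge0 ltW.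
have [pi0 fpi0] := feasible_exists htf hmu0 hmuT tfr.
pose S := [set total_cost tf w01 w12 pi | pi in feasible tf r mu0 muT].
have Slb pi : feasible tf r mu0 muT pi ->
    (ereal_inf S <= total_cost tf w01 w12 pi)%E.
  by move=> fpi; apply: ereal_inf_lbound; exists pi.
have S0 : (0 <= ereal_inf S)%E.
  apply: le_ereal_inf_tmp => _ [pi _ <-]; apply: integral_ge0 => t tt.
  by apply: le_trans (step_cost_le hw01 hw12 0%N tt); rewrite lee_fin step_cost_ge0.
(* If every feasible plan costs [+oo], the product plan is already a minimizer. *)
have [Soo|/eqP Soo] := eqVneq (ereal_inf S) +oo%E.
  exists pi0; split => // pi /Slb; rewrite Soo leye_eq => /eqP ->; exact: leey.
have Sfin : ereal_inf S \is a fin_num.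
  by rewrite ge0_fin_numE// ltey; apply/eqP.
have /choice[pi_ pi_P] (n : nat) : exists pi : {measure set (time_space R) -> \bar R},
    feasible tf r mu0 muT pi /\
    (total_cost tf w01 w12 pi < ereal_inf S + (n.+1%:R^-1)%:E)%E.
  have n0 : (0 : R) < n.+1%:R^-1 by rewrite invr_gt0.
  have [_ [pi fpi <-] piS] := lb_ereal_inf_adherent n0 Sfin.
  by exists pi.
have pi_feas n : feasible tf r mu0 muT (pi_ n) by case: (pi_P n).
pose leb : {measure set (measurableTypeR R) -> \bar R} := @lebesgue_measure R.
pose rleb : {measure set (measurableTypeR R) -> \bar R} := mscale (NngNum r0) leb.
pose nu1 : {measure set (measurableTypeR R) -> \bar R} :=
  mrestr rleb (measurable_horizon tf).
have mH := measurable_horizon tf.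
have mHC := measurableC mH.
have nu1E A : nu1 A = (r%:E * leb (A `&` horizon tf))%E by [].
have nu1T : (nu1 setT < +oo)%E.
  rewrite nu1E setTI (_ : leb _ = tf%:E); last exact: lebesgue_measure_horizon.
  by rewrite -EFinM ltry.
have pi_crossing n (A : set (measurableTypeR R)) : measurable A ->
    (pi_ n (@crossing R @^-1` A) <= nu1 A)%E.
  have [piC _ _ pic] := pi_feas n.
  exact: (crossing_le_restr (nu := rleb) piC pic).
have pi_departure n (A : set (measurableTypeR R)) : measurable A ->
    pi_ n (@departure R @^-1` A) = mu0 A.
  by have [_ + _ _] := pi_feas n; apply.
have pi_arrival n (A : set (measurableTypeR R)) : measurable A ->
    pi_ n (@arrival R @^-1` A) = muT A.
  by have [_ _ + _] := pi_feas n; apply.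
have mu0T : (mu0 setT < +oo)%E by rewrite probability_setT ltry.
have muTT : (muT setT < +oo)%E by rewrite probability_setT ltry.
have [|||U [pi [PU ooU piU]]] := @box_limit R mu0 nu1 muT mu0T nu1T muTT pi_.
- by move=> n A mA; rewrite pi_departure.
- exact: pi_crossing.
- by move=> n A mA; rewrite pi_arrival.
have pi_fin n (A B C : set (measurableTypeR R)) :
    measurable A -> measurable B -> measurable C ->
    pi_ n (A `*` B `*` C) \is a fin_num.
  move=> mA mB mC; rewrite ge0_fin_numE//; apply: le_lt_trans mu0T.
  rewrite -(pi_departure n)//; apply: le_measure; rewrite ?inE//.
    exact: measurable_box.
  exact: measurable_departure_preimage.
(* Prescribed marginals give constant sequences, so the limit plan inherits them exactly. *)
have limit_eq (mu : probability (measurableTypeR R) R)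
    (A B C : set (measurableTypeR R)) D :
    measurable A -> measurable B -> measurable C -> measurable D ->
    (forall n, pi_ n (A `*` B `*` C) = mu D) -> pi (A `*` B `*` C) = mu D.
  move=> mA mB mC mD pin; have [pif] := piU A B C mA mB mC.
  under eq_fun do rewrite pin.
  move=> /(cvg_unique (@Rhausdorff R) (cvg_cst _)) muD.
  by rewrite -(fineK pif) -muD fineK// fin_num_measure.
have pid (A : set (measurableTypeR R)) : measurable A ->
    pi (@departure R @^-1` A) = mu0 A.
  move=> mA; rewrite departure_preimageE; apply: limit_eq => // n.
  by rewrite -departure_preimageE pi_departure.
have pia (A : set (measurableTypeR R)) : measurable A ->
    pi (@arrival R @^-1` A) = muT A.
  move=> mA; rewrite arrival_preimageE; apply: limit_eq => // n.
  by rewrite -arrival_preimageE pi_arrival.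
have pic (A : set (measurableTypeR R)) : measurable A ->
    (pi (@crossing R @^-1` A) <= nu1 A)%E.
  move=> mA; rewrite crossing_preimageE.
  have [pif piA] := piU setT A setT measurableT mA measurableT.
  have nu1A : nu1 A \is a fin_num.
    by rewrite ge0_fin_numE//; apply: le_lt_trans nu1T; apply: le_measure; rewrite ?inE.
  rewrite -(fineK pif) -(fineK nu1A) lee_fin.
  apply: (ler_cvg_to piA (cvg_cst _)); apply: nearW => n.
  by rewrite fine_le ?pi_fin// -crossing_preimageE pi_crossing.
have piC : concentrated_on pi (time_cube tf).
  apply: concentrated_on_time_cube; rewrite ?pid ?pia//.
  apply/eqP; rewrite -measure_le0; apply: le_trans (pic _ mHC) _.
  by rewrite nu1E setICl measure0 mule0.
exists pi; split.
  split => // A mA; apply: le_trans (pic _ mA) _.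
  rewrite /nu1 /mrestr; apply: (@le_trans _ _ (rleb A)) => //.
  by apply: le_measure; rewrite ?inE//; exact: measurableI.
(* It remains to bound the cost of the limit by the infimum; semicontinuity applies with excess
   [n.+1%:R^-1] along the sequence. *)
move=> pi' /Slb; apply: le_trans; rewrite -(fineK Sfin).
apply: (@total_cost_lsc R tf w01 w12 hw01 hw12 U _ pi pi_) => //.
- by move=> A B C mA mB mC; case: (piU A B C mA mB mC).
- by move=> A B C mA mB mC; case: (piU A B C mA mB mC).
- by move=> n; rewrite EFinD fineK//; apply: ltW; case: (pi_P n).
Qed.
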